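(* There are $2^{2^{\aleph_0}}$ distinct homeomorphism classes among the spaces $M_A$, $A\subseteq\mathbb{R}$; that is, the set of equivalence classes of the family $\{M_A: A\subseteq\mathbb{R}\}$ under the relation of being homeomorphic has cardinality $2^{2^{\aleph_0}}$.
   Context: The Moore plane $M$ is the following topological space. As a set, $M$ is the disjoint union of the open upper half plane $\mathbb{R}^2_+=\{(x,y)\in\mathbb{R}^2: y>0\}$ and, for each $a\in\mathbb{R}$, a ray $R_a=\{(a,z): z\ge 0\}$ (the points of the rays are regarded as new points, distinct from the points of $\mathbb{R}^2_+$ and from the points of the other rays). Topology: $\mathbb{R}^2_+$ is open in $M$ and carries its usual topology; a point $(a,z)\in R_a$ has as basic open neighborhoods the sets, for $\varepsilon>0$, $$\{(a,w)\in R_a: w\ge 0,\ |w-z|<\varepsilon\}\ \cup\ \Big\{(x,y)\in\mathbb{R}^2_+: 0<y<\varepsilon,\ \Big|\tfrac{|x-a|}{y}-z\Big|<\varepsilon\Big\}.$$ Thus each $R_a$ is closed in $M$ with its usual topology, and a sequence $(x_n,y_n)$ in $\mathbb{R}^2_+$ converges to $(a,z)\in R_a$ if and only if $(x_n,y_n)\to(a,0)$ in $\mathbb{R}^2$ and $y_n/|x_n-a|\to 1/z$ (with $1/0=+\infty$, and $y_n/|x_n-a|=+\infty$ if $x_n=a$). For $A\subseteq\mathbb{R}$, $M_A=\mathbb{R}^2_+\cup\bigcup_{a\in A}R_a\subseteq M$ with the subspace topology; it is an open subset of $M$. *)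

(* Defs.v *)
From HB Require Import structures.
From mathcomp Require Import all_boot all_order all_algebra.
From mathcomp Require Import all_classical all_reals all_analysis.

Set Implicit Arguments.
Unset Strict Implicit.
Unset Printing Implicit Defensive.

Import Order.TTheory GRing.Theory Num.Theory.
Import numFieldNormedType.Exports.

Local Open Scope classical_set_scope.
Local Open Scope ring_scope.

(* [set_type A] carries the subspace topology, so [upper_half R] as a type has
   the usual topology induced by the product topology of [R * R]. *)
Definition upper_half (R : realType) : set (R * R) := [set p | 0 < p.2].

Definition half_line (R : realType) : set R := [set z | 0 <= z].

Arguments upper_half : clear implicits.
Arguments half_line : clear implicits.

(* [inl p] is a point of the half plane, [inr (a, z)] the point [(a, z)] of the
   ray [R_a]; the sum keeps all of them distinct. *)
Definition moore (R : realType) : Type :=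
  (set_type (upper_half R) + R * set_type (half_line R))%type.

HB.instance Definition _ (R : realType) := Choice.on (moore R).

Section MoorePlane.
Context {R : realType}.
Implicit Types (a e : R) (z w : half_line R).

Definition half_plane : set (moore R) := range inl.

Definition ray a : set (moore R) := range (fun z => inr (a, z)).

Definition moore_ball a z e : set (moore R) :=
  [set inr (a, w) | w in [set w | `|val w - val z| < e]] `|`
  [set inl p | p in [set p : upper_half R |
    0 < (val p).2 < e /\ `| `|(val p).1 - a| / (val p).2 - val z| < e]].

Definition moore_nbhs (q : moore R) : set_system (moore R) :=
  match q with
  | inl p => inl @ nbhs p
  | inr (a, z) => filter_from [set e | 0 < e] (moore_ball a z)
  end.

HB.instance Definition _ := hasNbhs.Build (moore R) moore_nbhs.

Let moore_nbhs_filter (q : moore R) : ProperFilter (nbhs q).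
Proof.
case: q => [p|[a z]].
  exact: fmap_proper_filter.
apply: filter_from_proper.
  apply: filter_from_filter; first by exists 1 => /=.
  move=> i j /= i0 j0; exists (Num.min i j); first by rewrite /= lt_min i0 j0.
  move=> q [[w /= + <-]|[p /= + <-]].
    by rewrite lt_min => /andP[? ?]; split; left; exists w.
  rewrite !lt_min => -[/andP[y0 /andP[yi yj]]] /andP[? ?].
  by split; right; exists p => //=; rewrite y0 ?yi ?yj.
by move=> e /= e0; exists (inr (a, z)); left; exists z => //=; rewrite subrr normr0.
Qed.

Let moore_nbhs_singleton (q : moore R) (A : set (moore R)) : nbhs q A -> A q.
Proof.
case: q => [p /= /nbhs_singleton//|[a z] [e /= e0]]; apply.
by left; exists z => //=; rewrite subrr normr0.
Qed.

Let upper_half_val_cvg (p : upper_half R) : val q @[q --> p] --> val p.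
Proof. exact: initial_continuous. Qed.

Let height_cvg (p : upper_half R) : (val q).2 @[q --> p] --> (val p).2.
Proof. by apply: cvg_comp; [exact: upper_half_val_cvg|exact: cvg_snd]. Qed.

Let slope_cvg a (p : upper_half R) :
  `|(val q).1 - a| / (val q).2 @[q --> p] --> `|(val p).1 - a| / (val p).2.
Proof.
have y0 : (val p).2 != 0 by apply: lt0r_neq0; exact: (set_valP p).
have cV : ((val q).2)^-1 @[q --> p] --> ((val p).2)^-1.
  exact: (cvgV y0 (@height_cvg p)).
have cN : `|(val q).1 - a| @[q --> p] --> `|(val p).1 - a|.
  have c1 : (val q).1 @[q --> p] --> (val p).1.
    by apply: cvg_comp; [exact: upper_half_val_cvg|exact: cvg_fst].
  exact: (cvg_norm (cvgB c1 (cvg_cst a))).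
exact: (cvgM cN cV).
Qed.

Let moore_nbhs_nbhs (q : moore R) (A : set (moore R)) :
  nbhs q A -> nbhs q (nbhs^~ A).
Proof.
case: q => [p /= pA|[a z] [e /= e0 eA]].
  by apply: nbhs_interior; exact: pA.
exists e => // q [[w /= we <-]|[p /= [/andP[y0 ye] pe] <-]].
  exists (e - `|val w - val z|); first by rewrite /= subr_gt0.
  move=> q' [[v /= vw <-]|[p /= [/andP[y0 ye] pe] <-]]; apply: eA.
    left; exists v => //=; rewrite -(subrKA (val w)).
    by rewrite (le_lt_trans (ler_normD _ _))// -ltrBrDr.
  right; exists p => //=; split.
    by rewrite y0 (lt_le_trans ye)// gerBl.
  rewrite -(subrKA (val w)) (le_lt_trans (ler_normD _ _))//.
  by rewrite -ltrBrDr.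
have y2 : \forall p' \near p, (val p').2 < e.
  exact: (height_cvg (lt_nbhsl ye)).
have sl : \forall p' \near p,
    `| `|(val p').1 - a| / (val p').2 - val z| < e.
  have c : `| `|(val q).1 - a| / (val q).2 - val z|
      @[q --> p] --> `| `|(val p).1 - a| / (val p).2 - val z|.
    exact: (cvg_norm (cvgB (@slope_cvg a p) (cvg_cst (val z)))).
  exact: (c _ (lt_nbhsl pe)).
change (\forall p' \near p, A (inl p')).
near=> p'; apply: eA; right; exists p' => //=; split; last by near: p'.
apply/andP; split; last by near: p'.
exact: (set_valP p').
Unshelve. all: by end_near. Qed.

HB.instance Definition _ := Nbhs_isNbhsTopological.Build (moore R)
  moore_nbhs_filter moore_nbhs_singleton moore_nbhs_nbhs.

Definition moore_on (A : set R) : set (moore R) :=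
  half_plane `|` \bigcup_(a in A) ray a.

End MoorePlane.

Definition homeomorphic (S T : topologicalType) : Prop :=
  exists (f : S -> T) (g : T -> S),
    [/\ continuous f, continuous g, cancel f g & cancel g f].

Definition homeomorphism_classes (T : topologicalType) (F : set (set T)) :
    set (set (set T)) :=
  [set [set Y | F Y /\ homeomorphic (set_type X) (set_type Y)] | X in F].

(* Main.v *)
Require Import Defs.
From mathcomp Require Import all_boot all_order all_algebra.
From mathcomp Require Import all_classical all_reals all_analysis.
From mathcomp Require Import lra.

(** There are at most [2^c] classes, [c] being the cardinal of the continuum,
because they are indexed by the subsets of the line.

For the lower bound it is enough that each class contains few of the spaces
[M_A]. Each of them contains the half plane as a dense subset, so the countably
many rational points of the half plane are dense in all of them at once. Since
the Moore plane is Hausdorff ([moore_hausdorff]), a continuous map from [M_B] to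
it is determined by its values at these points ([eq_continuous_rational]), and
there are only [c^aleph_0 = c] possible systems of values
([moore_families_embedding]). A homeomorphism from [M_B] onto [M_A], seen as
such a map, has [M_A] as its range and thus determines [A]; so at most [c] sets
[A] give a space homeomorphic to [M_B]. In other words, the power set of the
line embeds into [K * c], where [K] is the set of classes
([powerset_embedding]).

It remains to do some cardinal arithmetic. By Zorn's lemma, [K <= c] or
[K * c <= K] ([embedding_absorb]). The former would give [2^c <= c * c = c],
against Cantor's theorem, so the latter holds and [2^c <= K]. The identification
of [c] with the cardinal of [set nat] rests on rational cuts in one direction
([cut_injective]) and on ternary expansions in the other
([ternary_injective]). *)

Set Implicit Arguments.
Unset Strict Implicit.
Unset Printing Implicit Defensive.

Import Order.TTheory GRing.Theory Num.Theory.
Import numFieldNormedType.Exports.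

Local Open Scope classical_set_scope.
Local Open Scope card_scope.

(** * Cardinal arithmetic from Zorn's lemma *)

(** Comparability of cardinals. A maximal graph of a partial injection must be
defined on all of [T] or reach all of [U]: otherwise it could be enlarged by a
pair of missed points. *)
Lemma embedding_total (T U : Type) :
  (exists f : T -> U, injective f) \/ (exists g : U -> T, injective g).
Proof.
pose P (G : set (T * U)) :=
  forall p q, G p -> G q -> (p.1 = q.1 <-> p.2 = q.2).
have [F FP Ftot|G [PG maxG]] := @Zorn_bigcup _ P.
  move=> p q [X FX Xp] [Y FY Yq].
  have [XY|YX] := Ftot _ _ FX FY.
    exact: (FP _ FY p q (XY _ Xp) Yq).
  exact: (FP _ FX p q Xp (YX _ Yq)).
have [totG|/existsNP[t noU]] := pselect (forall t, exists u, G (t, u)).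
  have [f fG] := choice totG.
  by left; exists f => t t' ff; apply/(PG _ _ (fG t) (fG t')).
have [surG|/existsNP[u noT]] := pselect (forall u, exists t, G (t, u)).
  have [g gG] := choice surG.
  by right; exists g => u u' gg; apply/(PG _ _ (gG u) (gG u')).
exfalso; apply: (maxG (G `|` [set (t, u)])).
  split; first by move=> p; left.
  by move=> /(_ (t, u) (or_intror erefl)) Gtu; apply: noU; exists u.
move=> [t1 u1] [t2 u2] [G1|[-> ->]] [G2|[-> ->]] //=.
- exact: (PG _ _ G1 G2).
- by split=> e; subst; [case: noU; exists u1 | case: noT; exists t1].
- by split=> e; subst; [case: noU; exists u2 | case: noT; exists t2].
Qed.

(** A cardinal [K] larger than [C] absorbs the multiplication by [C]. A maximal
family [G] of injections [C -> K] with pairwise disjoint ranges covers all of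
[K] except for a remainder, which does not contain another copy of [C] and hence
embeds into [C]. If [G] is empty, the remainder is [K]. Otherwise multiplying by
[C] can be done inside each copy of [C], and the remainder times [C] fits into
the same copy as [g0 * C], the boolean keeping the two apart. *)
Lemma embedding_absorb (C K : Type) (code : C * C * bool -> C) :
  injective code ->
  (exists f : K -> C, injective f) \/ (exists f : K * C -> K, injective f).
Proof.
move=> codeI.
(* One condition for two requirements: [g = g'] gives the injectivity of each
member, and [g <> g'] the disjointness of ranges. *)
pose P (G : set (C -> K)) := forall g g' c c', G g -> G g' ->
  g c = g' c' -> g = g' /\ c = c'.
have [F FP Ftot|G [PG maxG]] := @Zorn_bigcup _ P.
  move=> g g' c c' [X FX Xg] [Y FY Yg'].
  have [XY|YX] := Ftot _ _ FX FY.
    exact: (FP _ FY _ _ _ _ (XY _ Xg) Yg').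
  exact: (FP _ FX _ _ _ _ Xg (YX _ Yg')).
pose covered k := exists gc : (C -> K) * C, G gc.1 /\ gc.1 gc.2 = k.
have [[c0 _]|noC] := pselect (exists c : C, True); last first.
  by right; exists fst => -[k c]; case: noC; exists c.
have [[h hI]|[q qI]] := embedding_total C {k | ~ covered k}.
  exfalso; pose g c := sval (h c).
  have gN c : ~ covered (g c) := svalP (h c).
  have gI : injective g.
    move=> c c'; rewrite /g => cc; apply: hI.
    by case: (h c) (h c') cc => k nk [k' nk'] /= kk; subst; congr exist.
  apply: (maxG (G `|` [set g])).
    split; first by move=> g' Gg'; left.
    by move=> /(_ g (or_intror erefl)) Gg; apply: (gN c0); exists (g, c0).
  move=> g1 g2 c1 c2 [G1|->] [G2|->]; first exact: PG.
  - by move=> e; case: (gN c2); exists (g1, c1).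
  - by move=> e; case: (gN c1); exists (g2, c2).
  - by move=> /gI.
have [[g0 Gg0]|noG] := pselect (exists g, G g); last first.
  left; have nc k : ~ covered k by move=> [[g c] [Gg _]]; apply: noG; exists g.
  by exists (fun k => q (exist _ k (nc k))) => k k' /qI [].
right.
pose Q (kc : K * C) k' :=
  (exists g c, [/\ G g, g c = kc.1 & k' = g (code (c, kc.2, false))]) \/
  (exists nk : ~ covered kc.1,
    k' = g0 (code (q (exist _ kc.1 nk), kc.2, true))).
have totQ kc : exists k', Q kc k'.
  have [[[g c] [/= Gg gc]]|nk] := pselect (covered kc.1).
    by exists (g (code (c, kc.2, false))); left; exists g, c.
  by exists (g0 (code (q (exist _ kc.1 nk), kc.2, true))); right; exists nk.
have [f fQ] := choice totQ.
exists f => -[k c] [k' c'] ff; have := fQ (k', c'); rewrite -ff.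
have [[g [d [Gg /= <- ->]]]|[nk /= ->]] := fQ (k, c).
  move=> [[g' [d' [Gg' /= <- e]]]|[nk' /= e]].
    by have [<- /codeI[-> ->]] := PG _ _ _ _ Gg Gg' e.
  by have [_ /codeI] := PG _ _ _ _ Gg Gg0 e.
move=> [[g' [d' [Gg' /= <- e]]]|[nk' /= e]].
  by have [_ /codeI] := PG _ _ _ _ Gg0 Gg' e.
by have [_ /codeI[/qI[-> ->]]] := PG _ _ _ _ Gg0 Gg0 e.
Qed.

(** Cantor's diagonal argument, for an injection out of the power set. *)
Lemma cantor_no_embedding (C : Type) (f : set C -> C) : ~ injective f.
Proof.
move=> fI; pose D := [set c | exists2 S, f S = c & ~ S c].
have [|nD] := pselect (D (f D)); first by move=> /[dup] Df [S /fI ->].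
by apply: (nD); exists D.
Qed.

Lemma image_injective (T U : Type) (f : T -> U) :
  injective f -> injective (fun A : set T => f @` A).
Proof.
move=> fI A B AB; apply/seteqP; split=> t.
  by move=> /(imageP f); rewrite AB => -[t' Bt' /fI <-].
by move=> /(imageP f); rewrite -AB => -[t' Bt' /fI <-].
Qed.

Lemma countable_sets_embedding (T : countType) :
  exists f : set T -> set nat, injective f.
Proof.
exists (fun A => pickle @` A); apply: image_injective.
exact: (pcan_inj pickleK).
Qed.

(** The hypothesis of [embedding_absorb] for the continuum. *)
Lemma set_nat_triple_embedding :
  exists code : set nat * set nat * bool -> set nat, injective code.
Proof.
have [f fI] := countable_sets_embedding (option (nat + nat)).
exists (fun p : set nat * set nat * bool => f [set o | match o with
  | Some (inl n) => p.1.1 n | Some (inr n) => p.1.2 n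
  | None => is_true p.2 end]).
move=> [[A B] b] [[A' B'] b'] /fI /= E.
have EE o := congr1 (fun S : set (option (nat + nat)) => S o) E.
congr (_, _, _).
- by apply/funext => n; exact: (EE (Some (inl n))).
- by apply/funext => n; exact: (EE (Some (inr n))).
- by have := EE None => /=; case: b b' {E EE} => -[] // e;
    [have : false by rewrite -e | have : false by rewrite e].
Qed.

(** * Real numbers and sets of natural numbers *)

Local Open Scope ring_scope.

Section Ternary.
Variable R : realType.

Lemma cut_injective : injective (fun x : R => [set q : rat | ratr q < x]).
Proof.
move=> x y e; apply/eqP; rewrite eq_le; apply/andP; split; rewrite leNgt;
  apply/negP => /rat_in_itvoo[q]; rewrite inE /= => /andP[h1 h2].
  have : [set q : rat | ratr q < x] q by [].
  by rewrite e /= ltNge (ltW h1).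
have : [set q : rat | ratr q < y] q by [].
by rewrite -e /= ltNge (ltW h1).
Qed.

Definition ternary_sum (A : set nat) (n : nat) : R :=
  \sum_(i < n) `[< A i >]%:R * 3^-1 ^+ i.

(** The digits from position [n] on contribute less than
[3^-n + 3^-(n+1) + ... = 3/2 * 3^-n]; the exact remainder in the upper bound is
what makes the induction go through. *)
Lemma ternary_sum_tail A n k :
  ternary_sum A n <= ternary_sum A (n + k) <=
    ternary_sum A n + 3 / 2 * 3^-1 ^+ n - 3 / 2 * 3^-1 ^+ (n + k).
Proof.
elim: k => [|k /andP[IH1 IH2]]; first by rewrite addn0; lra.
have -> : ternary_sum A (n + k.+1) =
    ternary_sum A (n + k) + `[< A (n + k)%N >]%:R * 3^-1 ^+ (n + k).
  by rewrite addnS /ternary_sum big_ord_recr.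
rewrite addnS exprS.
have : 0 <= 3^-1 ^+ (n + k) :> R by rewrite exprn_ge0// invr_ge0.
by move: (3^-1 ^+ (n + k)) IH1 IH2 => z; case: `[< _ >] => /=; lra.
Qed.

Lemma has_sup_ternary A : has_sup (range (ternary_sum A)).
Proof.
split; first by exists (ternary_sum A 0), 0%N.
exists (3 / 2) => _ [n _ <-]; have /andP[_] := ternary_sum_tail A 0 n.
rewrite add0n /ternary_sum big_ord0 expr0.
have : 0 <= 3^-1 ^+ n :> R by rewrite exprn_ge0// invr_ge0.
by lra.
Qed.

Definition ternary A : R := sup (range (ternary_sum A)).

(** At the first digit where two sets differ, the larger one gains [3^-n], while
all the later digits of the other one are worth at most half of that. *)
Lemma ternary_lt A B n :
  (forall i, (i < n)%N -> A i = B i) -> ~ A n -> B n -> ternary A < ternary B.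
Proof.
move=> AB nA Bn.
have S : ternary_sum A n = ternary_sum B n.
  by apply: eq_bigr => i _; rewrite AB.
have SA : ternary_sum A n.+1 = ternary_sum A n.
  by rewrite /ternary_sum big_ord_recr /= asboolF// mul0r addr0.
have SB : ternary_sum B n.+1 = ternary_sum B n + 3^-1 ^+ n.
  by rewrite /ternary_sum big_ord_recr /= asboolT// mul1r.
have z0 : 0 < 3^-1 ^+ n :> R by rewrite exprn_gt0// invr_gt0.
have uA : ternary A <= ternary_sum A n + 3^-1 ^+ n / 2.
  apply: ge_sup => [|_ [m _ <-]]; first by case: (has_sup_ternary A).
  have [nm|mn] := leqP n.+1 m.
    have /andP[_] := ternary_sum_tail A n.+1 (m - n.+1).
    have : 0 <= 3^-1 ^+ m :> R by rewrite exprn_ge0// invr_ge0.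
    by rewrite subnKC// SA exprS; lra.
  have /andP[+ _] := ternary_sum_tail A m (n - m).
  by rewrite subnKC//; lra.
have lB : ternary_sum B n.+1 <= ternary B.
  by apply: ub_le_sup; [case: (has_sup_ternary B)|exists n.+1].
by move: uA lB; rewrite SB S; lra.
Qed.

Lemma ternary_injective : injective ternary.
Proof.
move=> A B AB; apply: contrapT => nAB.
have : exists n, `[< A n >] != `[< B n >].
  apply: contrapT => h; apply: nAB; apply/funext => n.
  apply: contrapT => ABn; apply: h; exists n; apply/eqP => e.
  by apply: ABn; apply: propext; exact: asbool_eq_equiv.
move=> /ex_minnP[n nE nmin].
have agree i : (i < n)%N -> A i = B i.
  move=> lin; apply: propext; apply: asbool_eq_equiv.
  apply: contrapT => /eqP /nmin.
  by rewrite leqNgt lin.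
have [An|nAn] := pselect (A n); have [Bn|nBn] := pselect (B n).
- by move: nE; rewrite !asboolT.
- have /ternary_lt := fun i h => esym (agree i h).
  by move=> /(_ nBn An); rewrite AB ltxx.
- by have := ternary_lt agree nAn Bn; rewrite AB ltxx.
- by move: nE; rewrite !asboolF.
Qed.
End Ternary.

(** * Topology of the Moore plane *)

Lemma nbhs_set_type (T : topologicalType) (A : set T) (x : A) (U : set A) :
  nbhs x U -> exists2 V, nbhs (val x) V & forall y : A, V (val y) -> U y.
Proof.
move=> [_ [[W oW <-] Wx WU]]; exists W => //.
exact: open_nbhs_nbhs.
Qed.

(** The set on which two continuous maps into a Hausdorff space agree is closed;
stated at a point so that it can be applied in two stages. *)
Lemma eq_hausdorff_closure (S T : topologicalType) (f g : S -> T) (x : S) :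
  hausdorff_space T -> continuous f -> continuous g ->
  (forall U, nbhs x U -> exists2 y, U y & f y = g y) -> f x = g x.
Proof.
move=> hT cf cg dx; apply: hT => A B fA gB.
have [y [Ay By] fgy] : exists2 y, (f @^-1` A `&` g @^-1` B) y & f y = g y.
  by apply/dx/filterI; [exact: cf|exact: cg].
by exists (f y); split=> //; rewrite fgy.
Qed.

Section Moore.
Variable R : realType.
Local Notation M := (moore R).

(** The map that collapses every ray to its base point on the boundary line.
It is continuous into the Euclidean plane, and so separates all pairs of points
except those on a common ray. *)
Definition boundary_projection (q : M) : R * R :=
  match q with inl p => val p | inr (a, z) => (a, 0) end.

Lemma boundary_projection_continuous : continuous boundary_projection.
Proof.
case=> [p|[a z]].
  change ((val : upper_half R -> R * R) @ p --> val p).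
  exact: initial_continuous.
have FF : Filter (nbhs (inr (a, z) : M)) by exact: nbhs_filter.
apply/(@cvg_ballP _ _ _ _ FF) => eps eps0.
have z0 : 0 <= val z by exact: (set_valP z).
(* In the neighborhood of radius [e <= 1], [|x - a| / y < val z + 1], so that
[|x - a| < e * (val z + 1)]. *)
exists (Num.min 1 (eps / (val z + 1))).
  by rewrite /= lt_min ltr01 divr_gt0 ?ltr_wpDl.
move=> _ [[w _ <-]|[p /= + <-]].
  by split; exact: ballxx.
rewrite !lt_min; set y := (val p).2; set x := (val p).1.
move=> [/andP[y0 /andP[y1 ye]] /andP[s1 _]].
have yz : y * (val z + 1) < eps by rewrite -ltr_pdivlMr ?ltr_wpDl.
have xy : `|x - a| < y * (val z + 1).
  rewrite mulrC -ltr_pdivrMr// -ltrBlDl; exact: le_lt_trans (ler_norm _) s1.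
split; rewrite /ball /=.
  by rewrite distrC; apply: lt_trans yz.
rewrite sub0r normrN gtr0_norm//; apply: le_lt_trans yz.
by apply: ler_peMr; [exact: ltW|rewrite lerDr].
Qed.

(** Two points of a common ray, which [boundary_projection] does not tell apart,
have disjoint neighborhoods of radius half their distance. *)
Lemma moore_hausdorff : hausdorff_space M.
Proof.
move=> p q pq.
have : boundary_projection p = boundary_projection q.
  have hRR : hausdorff_space (R * R)%type by exact: norm_hausdorff.
  apply: hRR => A B pA qB.
  have [m [mA mB]] := pq _ _ (boundary_projection_continuous pA)
    (boundary_projection_continuous qB).
  by exists (boundary_projection m).
case: p q pq => [p|[a z]] [q|[b w]] pq /=.
- by move=> /val_inj ->.
- by move=> e; have := set_valP p; rewrite /upper_half /= e /= ltxx.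
- by move=> e; have := set_valP q; rewrite /upper_half /= -e /= ltxx.
move=> [ab]; rewrite -{b}ab in pq *.
have [zw|zw] := eqVneq (val z) (val w); first by rewrite (val_inj zw).
exfalso; pose e := `|val z - val w| / 2.
have e0 : 0 < e by rewrite divr_gt0// normr_gt0 subr_eq0.
have disj t : `|t - val z| < e -> `|t - val w| < e -> False.
  move=> tz tw; have := ler_distD t (val z) (val w).
  by rewrite (distrC _ t); move: tz tw; rewrite /e; lra.
have [||m [[[v /= vz <-]|[v /= [_ vz] <-]] mw]] :=
  pq (moore_ball a z e) (moore_ball a w e).
- by exists e.
- by exists e.
- by case: mw => [[v' /= vw [vv]]|[//]]; rewrite vv in vw; exact: disj vw.
- by case: mw => [[//]|[v' /= [_ vw] [vv]]]; rewrite vv in vw; exact: disj vw.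
Qed.

Lemma rational_dense_upper_half (p : upper_half R) (U : set (upper_half R)) :
  nbhs p U -> exists2 u, U u &
    exists i : rat * rat, val u = (ratr i.1, ratr i.2).
Proof.
move=> /nbhs_set_type[V /nbhs_ballP[e /= e0 eV] VU].
have p0 : 0 < (val p).2 by exact: (set_valP p).
have [q1 /andP[a1 b1]] : exists q, (val p).1 < ratr q < (val p).1 + e.
  have /rat_in_itvoo[q] : (val p).1 < (val p).1 + e by rewrite ltrDl.
  by rewrite in_itv; exists q.
have [q2 /andP[a2 b2]] : exists q, (val p).2 < ratr q < (val p).2 + e.
  have /rat_in_itvoo[q] : (val p).2 < (val p).2 + e by rewrite ltrDl.
  by rewrite in_itv; exists q.
have uP : (ratr q1, ratr q2) \in upper_half R.
  by rewrite inE /upper_half /=; exact: lt_trans a2.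
exists (SigSub uP); last by exists (q1, q2).
apply/VU/eV; split; rewrite /ball /= ltr_distlC.
  by apply/andP; split=> //; lra.
by apply/andP; split=> //; lra.
Qed.

(** The slanted line [x = a + z * y] stays in every neighborhood of [(a, z)]
for small [y]. *)
Lemma half_plane_dense (q : M) (U : set M) : nbhs q U -> exists p, U (inl p).
Proof.
case: q => [p Up|[a z] [e /= e0 eU]].
  by exists p; exact: nbhs_singleton Up.
have uP : (a + val z * (e / 2), e / 2) \in upper_half R.
  by rewrite inE /upper_half /= divr_gt0.
exists (SigSub uP); apply: eU; right; exists (SigSub uP) => //=.
have z0 : 0 <= val z by exact: (set_valP z).
have e20 : 0 < e / 2 by rewrite divr_gt0.
have -> : a + val z * (e / 2) - a = val z * (e / 2) by rewrite addrC addKr.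
rewrite e20 (ger0_norm (mulr_ge0 z0 (ltW e20))).
rewrite mulfK ?gt_eqF// subrr normr0; split=> //; lra.
Qed.

Definition ray_origin : half_line R :=
  SigSub (mem_set (lexx 0) : 0 \in half_line R).

Lemma moore_on_inl A p : @moore_on R A (inl p).
Proof. by left; exists p. Qed.

Lemma moore_on_injective : injective (@moore_on R).
Proof.
have key A a : moore_on A (inr (a, ray_origin)) <-> A a.
  split=> [[[? _ //]|[b Ab [z _ [<- _]]]] //|Aa].
  by right; exists a => //; exists ray_origin.
by move=> A B e; apply/funext => a; apply/propext; rewrite -!key e.
Qed.

(** The points of the half plane with rational coordinates are dense in every
[moore_on A]. The agreement of [f] and [g] first spreads from them to the half
plane and then to the rays. *)
Lemma eq_continuous_rational (A : set R) (f g : set_type (@moore_on R A) -> M) :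
  continuous f -> continuous g ->
  (forall (b : set_type (moore_on A)) (p : upper_half R) (i : rat * rat),
     val b = inl p -> val p = (ratr i.1, ratr i.2) -> f b = g b) ->
  f = g.
Proof.
move=> cf cg fg.
have fgl (b : set_type (moore_on A)) (p : upper_half R) :
    val b = inl p -> f b = g b.
  move=> bp; apply: (eq_hausdorff_closure (@moore_hausdorff) cf cg).
  move=> U /nbhs_set_type[V bV VU]; rewrite bp in bV.
  have [u Vu [i ui]] := rational_dense_upper_half bV.
  pose b' : set_type (moore_on A) := SigSub (mem_set (moore_on_inl A u)).
  by exists b'; [exact: VU|exact: (fg b' u i erefl ui)].
apply/funext => b; apply: (eq_hausdorff_closure (@moore_hausdorff) cf cg).
move=> U /nbhs_set_type[V /half_plane_dense[p Vp] VU].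
pose b' : set_type (moore_on A) := SigSub (mem_set (moore_on_inl A p)).
by exists b'; [exact: VU|exact: (fgl b' p erefl)].
Qed.

End Moore.

(** * Counting homeomorphisms *)

Lemma homeomorphic_refl (T : topologicalType) : homeomorphic T T.
Proof. by exists id, id; split=> // x A. Qed.

Section Count.
Variable R : realType.
Local Notation M := (moore R).

Definition moore_coordinates (q : M) : bool * R * R :=
  match q with
  | inl p => (false, (val p).1, (val p).2)
  | inr (a, z) => (true, a, val z)
  end.

Lemma moore_coordinates_injective : injective moore_coordinates.
Proof.
move=> [p|[a z]] [q|[b w]] //= [].
  move=> e1 e2; congr inl; apply: val_inj.
  by rewrite [LHS]surjective_pairing e1 e2 -surjective_pairing.
by move=> -> /val_inj ->.
Qed.

(** There are only continuum many maps from a countable set to the Moore plane: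
such a map is recorded by the rational cuts of the coordinates of its values. *)
Lemma moore_families_embedding :
  exists f : (rat * rat -> M) -> set nat, injective f.
Proof.
have [e eI] := countable_sets_embedding (rat * rat * option (bool * rat))%type.
pose cuts (g : rat * rat -> M) := [set s : rat * rat * option (bool * rat) |
  let c := moore_coordinates (g s.1) in
  match s.2 with
  | None => is_true c.1.1
  | Some (b, q) => is_true (ratr q < (if b then c.2 else c.1.2))
  end].
exists (e \o cuts); apply: inj_comp eI _ => g g' gg'.
have E i o := congr1 (fun S : set _ => S (i, o)) gg'.
apply/funext => i; apply: moore_coordinates_injective.
have E0 := E i None; have E1 q := E i (Some (false, q)).
have E2 q := E i (Some (true, q)); rewrite /cuts /= in E0 E1 E2.
case: (moore_coordinates (g i)) (moore_coordinates (g' i))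
  E0 E1 E2 => [[b x] y] [[b' x'] y'] /= E0 E1 E2.
congr (_, _, _).
- by apply/idP/idP; rewrite E0.
- by apply: cut_injective; apply/funext.
- by apply: cut_injective; apply/funext.
Qed.

Definition homeomorphism_class (A : set R) : set (set M) :=
  [set Y | [set moore_on A | A in [set: set R]] Y /\
    homeomorphic (set_type (moore_on A)) (set_type Y)].

(** [g] is the trace on the rational points of a continuous map from
[moore_on B] onto [moore_on A]. As a function of [rat * rat], this trace lives
in a type that does not depend on [B]; its values at the points outside the open
half plane are arbitrary. *)
Definition parametrizes (B : set R) (g : rat * rat -> M) (A : set R) :=
  exists f : set_type (moore_on B) -> M,
    [/\ continuous f, range f = moore_on A &
        forall (b : set_type (moore_on B)) (p : upper_half R) i,
          val b = inl p -> val p = (ratr i.1, ratr i.2) -> g i = f b].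

(** A continuous map is determined by its trace, and so are its range and
[A]. *)
Lemma parametrizes_inj B g A A' :
  parametrizes B g A -> parametrizes B g A' -> A = A'.
Proof.
move=> [f [cf fA fg]] [f' [cf' fA' fg']]; apply: (@moore_on_injective R).
rewrite -fA -fA'; suff -> : f = f' by [].
apply: eq_continuous_rational => //.
by move=> b p i bp pi; rewrite -(fg _ _ _ bp pi) -(fg' _ _ _ bp pi).
Qed.

Lemma homeomorphic_parametrizes B A :
  homeomorphic (set_type (moore_on B)) (set_type (moore_on A)) ->
  exists g, parametrizes B g A.
Proof.
move=> [f [h [cf ch fh hf]]].
pose f' (b : set_type (moore_on B)) : M := val (f b).
pose trace (i : rat * rat) (y : M) :=
  forall (b : set_type (moore_on B)) (p : upper_half R),
    val b = inl p -> val p = (ratr i.1, ratr i.2) -> y = f' b.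
suff [g gP] : {g : rat * rat -> M & forall i, trace i (g i)}.
  exists g, f'; split; last by move=> b p i; exact: gP.
    move=> b; apply: continuous_comp; first exact: cf.
    exact: initial_continuous.
  apply/seteqP; split=> [_ [b _ <-]|y Ay]; first exact: (set_valP (f b)).
  exists (h (SigSub (mem_set Ay))) => //.
  by rewrite /f' hf.
apply: choice => i.
have [[b [p [bp pi]]]|no] := pselect
    (exists (b : set_type (moore_on B)) (p : upper_half R),
      val b = inl p /\ val p = (ratr i.1, ratr i.2)).
  exists (f' b) => b' p' bp' pi'; congr f'; apply: val_inj.
  by rewrite bp bp'; congr inl; apply: val_inj; rewrite pi pi'.
(* Here [i] is not in the open half plane and any value will do. *)
by exists (inr (0, ray_origin R)) => b p bp pi; case: no; exists b, p.
Qed.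

(** Each homeomorphism class contains at most continuum many [moore_on A]: once
a representative [B] of the class is chosen, [A] is recovered from the class and
the trace of any homeomorphism of [moore_on B] onto [moore_on A]. *)
Lemma powerset_embedding :
  exists f : set R -> ({k | range homeomorphism_class k} * set nat)%type,
    injective f.
Proof.
have [e eI] := moore_families_embedding.
pose k A : {k | range homeomorphism_class k} :=
  exist _ (homeomorphism_class A) (imageP _ I).
have repP (c : {k | range homeomorphism_class k}) :
    exists B, homeomorphism_class B = sval c.
  by have [B _ Bc] := svalP c; exists B.
have [rep repK] := choice repP.
have gP A : exists g, parametrizes (rep (k A)) g A.
  apply: homeomorphic_parametrizes.
  have : homeomorphism_class A (moore_on A).
    by split; [exists A|exact: homeomorphic_refl].
  by rewrite -[homeomorphism_class A](repK (k A)) => -[].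
have [g {}gP] := choice gP.
exists (fun A => (k A, e (g A))) => A A' [kk /eI gg].
have kk' : k A = k A' by exact: eq_sig_hprop.
apply: parametrizes_inj (gP A) _; rewrite kk' gg; exact: gP.
Qed.

End Count.

Theorem proposition3p2 (R : realType) :
  homeomorphism_classes [set moore_on A | A in [set: set R]]
    #= [set: set (set nat)].
Proof.
have -> : homeomorphism_classes [set moore_on A | A in [set: set R]]
    = range (@homeomorphism_class R).
  by rewrite /homeomorphism_classes image_comp.
apply: Cantor_Bernstein.
  apply: card_le_trans (card_image_le _ _) _.
  have [e eI] := countable_sets_embedding rat.
  apply/pcard_injP.
  exists (fun A : set R => (e \o (fun x => [set q | ratr q < x])) @` A).
  exact: (in2W (image_injective (inj_comp eI (@cut_injective R)))).
have [code codeI] := set_nat_triple_embedding.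
have [f fI] := powerset_embedding R.
have tI : injective (fun A : set (set nat) => ternary R @` A).
  exact/image_injective/(@ternary_injective R).
(* If there were at most continuum many classes, [powerset_embedding] would
bound the power set of the continuum by the continuum. *)
have [[h hI]|[h hI]] :=
  embedding_absorb {k | range (@homeomorphism_class R) k} codeI.
  exfalso.
  apply: (@cantor_no_embedding _ (fun A => let p := f (ternary R @` A) in
    code (h p.1, p.2, true))).
  by move=> A B /codeI[/hI e1 e2]; apply/tI/fI/injective_projections.
pose u (A : set (set nat)) := sval (h (f (ternary R @` A))).
have uI : injective u.
  move=> A B AB; apply/tI/fI/hI; exact: eq_sig_hprop.
rewrite -(card_le_eql (inj_card_eq (in2W uI))).
by apply: subset_card_le => _ [A _ <-]; exact: svalP.
Qed.
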